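(* Let $G$ be a graph of order $n$ with stability number $\alpha$ (so $1\le \alpha\le n$). Then \[ F(G)\le f_{\sf T}(n,\alpha)=\left(\left\lceil\tfrac{n}{\alpha}\right\rceil+1\right)^{p}\left(\left\lfloor\tfrac{n}{\alpha}\right\rfloor+1\right)^{\alpha-p},\qquad p=n \bmod \alpha, \] with equality if and only if $G\simeq T_{n,\alpha}$.
   Context: All graphs are finite, simple and undirected. The Fibonacci index $F(G)$ of a graph $G$ is the number of stable (independent) sets of $G$, including the empty set. The stability number $\alpha(G)$ is the maximum size of a stable set. For integers $1\le\alpha\le n$, the Turán graph $T_{n,\alpha}$ is the disjoint union of $\alpha$ cliques whose orders sum to $n$ and differ pairwise by at most one (so each has $\lceil n/\alpha\rceil$ or $\lfloor n/\alpha\rfloor$ vertices); $f_{\sf T}(n,\alpha)$ denotes $F(T_{n,\alpha})$. *)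

(* Defs.v *)
From mathcomp Require Import all_boot.

Set Implicit Arguments.
Unset Strict Implicit.
Unset Printing Implicit Defensive.

Record sgraph := SGraph {
  vertex :> finType;
  adj : rel vertex;
  adj_sym : symmetric adj;
  adj_irr : irreflexive adj }.

Arguments adj {G} x y : rename.

Definition stable (G : sgraph) (S : {set G}) : bool :=
  [forall x in S, forall y in S, ~~ adj x y].

Definition fibonacci_index (G : sgraph) : nat :=
  #|[set S : {set G} | stable S]|.

Definition stability_number (G : sgraph) : nat :=
  \max_(S : {set G} | stable S) #|S|.

Definition isomorphic (G H : sgraph) : Prop :=
  exists f : G -> H, bijective f /\ {mono f : x y / adj x y}.

Section DisjointCliques.
Variables (a : nat) (q : 'I_a -> nat).

Definition cliques_vertex : finType := {i : 'I_a & 'I_(q i)}.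

Definition cliques_adj : rel cliques_vertex :=
  fun u v => (tag u == tag v) && (u != v).

Lemma cliques_adj_sym : symmetric cliques_adj.
Proof. by move=> u v; rewrite /cliques_adj eq_sym [u == v]eq_sym. Qed.

Lemma cliques_adj_irr : irreflexive cliques_adj.
Proof. by move=> u; rewrite /cliques_adj !eqxx. Qed.

(* The disjoint union of a cliques, the i-th one having q i vertices. *)
Definition disjoint_cliques : sgraph :=
  SGraph cliques_adj_sym cliques_adj_irr.
End DisjointCliques.

Definition ceil_divn (m d : nat) : nat := (m + d.-1) %/ d.

(* Orders with sum n (sum_turan_order) and pairwise differences at most one
   (turan_order_balanced) are unique up to reordering; the larger ones come
   first here. *)
Definition turan_order (n a : nat) (i : 'I_a) : nat :=
  if i < n %% a then ceil_divn n a else n %/ a.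

Definition turan (n a : nat) : sgraph := disjoint_cliques (@turan_order n a).

Definition f_turan (n a : nat) : nat := fibonacci_index (turan n a).

Lemma leq_ceil_divn (m d k : nat) :
  0 < d -> (ceil_divn m d <= k) = (m <= k * d).
Proof.
case: d => // d _; rewrite /ceil_divn /= -ltnS ltn_divLR // mulSn.
by rewrite addSn ltnS addnC leq_add2l.
Qed.

Lemma ceil_divnE (m d : nat) :
  0 < d -> ceil_divn m d = m %/ d + (0 < m %% d).
Proof.
move=> d0; apply/eqP; rewrite eqn_leq leq_ceil_divn // mulnDl.
rewrite {1}(divn_eq m d) leq_add2l.
case: posnP => [->|mpos] /=.
  by rewrite addn0 /ceil_divn leq_div2r ?leq_addr.
rewrite mul1n (ltnW (ltn_pmod _ d0)) addn1 /= ltnNge leq_ceil_divn // -ltnNge.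
by rewrite {2}(divn_eq m d) -[X in X < _]addn0 ltn_add2l.
Qed.

Lemma turan_orderE (n a : nat) (i : 'I_a) :
  turan_order n i = n %/ a + (i < n %% a).
Proof.
rewrite /turan_order; case: ltnP => ip /=; last by rewrite addn0.
have a0 : 0 < a by apply: leq_ltn_trans (ltn_ord i).
by rewrite ceil_divnE // (leq_ltn_trans _ ip).
Qed.

Lemma sum_turan_order (n a : nat) :
  0 < a -> \sum_(i < a) turan_order n i = n.
Proof.
move=> a0; under eq_bigr => i _ do rewrite turan_orderE.
rewrite big_split /= sum_nat_const card_ord mulnC {3}(divn_eq n a).
congr (_ + _).
rewrite -(big_mkord xpredT (fun i => (i < n %% a) : nat)).
rewrite (big_cat_nat (n := n %% a)) //=; last exact/ltnW/ltn_pmod.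
rewrite [X in _ + X]big_nat_cond [X in _ + X]big1 => [|i]; last first.
  by rewrite andbT => /andP[/leq_gtF->].
rewrite addn0 (eq_big_nat _ _ (F2 := fun=> 1)) => [|i /andP[_ ->]//].
by rewrite sum_nat_const_nat subn0 muln1.
Qed.

Lemma turan_order_balanced (n a : nat) (i j : 'I_a) :
  turan_order n i <= (turan_order n j).+1.
Proof.
by rewrite !turan_orderE -addnS leq_add2l; case: (_ < _).
Qed.

Lemma stability_number_bounds (G : sgraph) :
  0 < #|vertex G| -> 1 <= stability_number G <= #|vertex G|.
Proof.
move=> /card_gt0P[x _]; apply/andP; split; last first.
  by apply/bigmax_leqP => S _; apply: max_card.
apply: (bigmax_sup [set x]); last by rewrite cards1.
apply/forall_inP => y /set1P->; apply/forall_inP => z /set1P->.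
by rewrite adj_irr.
Qed.

(* Main.v *)
(* Let v be a vertex of A lying in the largest number of stable subsets of A,
   let B be its closed neighbourhood in A, and write F for the number of stable
   subsets. A stable subset of A either avoids B or contains some u in B, and at
   most F(A \ B) of them contain a given u, hence F(A) <= (|B| + 1) F(A \ B).
   Since A \ B has smaller stability number, iterating gives at most a classes,
   of orders q_i with sum n, such that F(G) <= prod (q_i + 1), and equality
   forces these classes to be disjoint cliques. The product is largest for
   balanced q_i because log lies, at integers, below its chord through two
   consecutive integers, touching it only there. *)

Require Import Defs.
From mathcomp Require Import all_boot.
From mathcomp Require Import fingroup perm.
From mathcomp Require Import zify.

Set Implicit Arguments.
Unset Strict Implicit.
Unset Printing Implicit Defensive.

(** * Products of integers with a given sum *)

(* [x <= k (1 + 1/k)^(x - k)], with denominators cleared. *)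
Lemma leqif_chord (k x : nat) : 0 < k ->
  x * k ^ x * k.+1 ^ k <= k ^ k.+1 * k.+1 ^ x ?= iff (k <= x <= k.+1).
Proof.
move=> k0.
have p0 e : 0 < k ^ e by rewrite expn_gt0 k0.
have q0 e : 0 < k.+1 ^ e by rewrite expn_gt0.
have base : k * k ^ k * k.+1 ^ k = k ^ k.+1 * k.+1 ^ k by rewrite expnS.
have base1 : k.+1 * k ^ k.+1 * k.+1 ^ k = k ^ k.+1 * k.+1 ^ k.+1.
  by rewrite !expnS; lia.
(* From [y] to [y + 1] the left side is multiplied by [k(y + 1)/y] and the right side by [k + 1],
   which is larger exactly when [y > k]. *)
have up y : k < y -> y * k ^ y * k.+1 ^ k <= k ^ k.+1 * k.+1 ^ y ->
    y.+1 * k ^ y.+1 * k.+1 ^ k < k ^ k.+1 * k.+1 ^ y.+1.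
  move=> ky IH; rewrite [k ^ y.+1]expnS [k.+1 ^ y.+1]expnS.
  apply: (@leq_trans (k.+1 * (y * k ^ y * k.+1 ^ k))); last first.
    by rewrite [X in _ <= X]mulnCA leq_mul2l IH orbT.
  have -> : y.+1 * (k * k ^ y) * k.+1 ^ k = (y.+1 * k) * (k ^ y * k.+1 ^ k) by lia.
  have -> : k.+1 * (y * k ^ y * k.+1 ^ k) = (k.+1 * y) * (k ^ y * k.+1 ^ k) by lia.
  by rewrite ltn_pmul2r ?muln_gt0 ?p0 ?q0 //; lia.
(* The same comparison backwards: [y < k] gives [(k + 1)y < k(y + 1)]. *)
have down y : y < k -> y.+1 * k ^ y.+1 * k.+1 ^ k <= k ^ k.+1 * k.+1 ^ y.+1 ->
    y * k ^ y * k.+1 ^ k < k ^ k.+1 * k.+1 ^ y.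
  move=> yk; rewrite [k ^ y.+1]expnS [k.+1 ^ y.+1]expnS => IH.
  rewrite -(ltn_pmul2l (ltn0Sn k)).
  apply: (@leq_trans (y.+1 * (k * k ^ y) * k.+1 ^ k)); last first.
    by rewrite [X in _ <= X]mulnCA.
  have -> : y.+1 * (k * k ^ y) * k.+1 ^ k = (y.+1 * k) * (k ^ y * k.+1 ^ k) by lia.
  have -> : k.+1 * (y * k ^ y * k.+1 ^ k) = (k.+1 * y) * (k ^ y * k.+1 ^ k) by lia.
  by rewrite ltn_pmul2r ?muln_gt0 ?p0 ?q0 //; lia.
case: (ltnP x k) => [xk|kx] /=.
  suff: forall j, j < k -> (k - j.+1) * k ^ (k - j.+1) * k.+1 ^ k
      < k ^ k.+1 * k.+1 ^ (k - j.+1).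
    move=> /(_ (k - x.+1)); have -> : k - (k - x.+1).+1 = x by lia.
    move=> lt_x; have {}lt_x := lt_x ltac:(lia).
    by split; [exact: ltnW | rewrite ltn_eqF].
  elim=> [|j IH] jk; (apply: down; first by lia).
    by have -> : (k - 1).+1 = k by [lia]; rewrite base.
  have -> : (k - j.+2).+1 = k - j.+1 by lia.
  by apply/ltnW/IH; lia.
case: (ltnP k.+1 x) => [kx1|xk1] /=.
  (* The strict range starts at [k + 2], because [k + 1] is still an equality case and serves as the
     base of the induction. *)
  suff: forall j, (k + j.+2) * k ^ (k + j.+2) * k.+1 ^ k
      < k ^ k.+1 * k.+1 ^ (k + j.+2).
    move=> /(_ (x - k.+2)); have -> : k + (x - k.+2).+2 = x by lia.
    by move=> lt_x; split; [exact: ltnW | rewrite ltn_eqF].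
  elim=> [|j IH]; rewrite addnS; (apply: up; first by lia).
    by rewrite addn1 base1.
  exact: ltnW.
have [->|->] : x = k \/ x = k.+1 by lia.
  by rewrite base; split; rewrite ?eqxx.
by rewrite base1; split; rewrite ?eqxx.
Qed.

(** One strict factor makes the whole product strict, since the other factors of the upper bound are
    positive. *)
Lemma leqif_prod (I : finType) (E1 E2 : I -> nat) (C : pred I) :
  (forall i, E1 i <= E2 i ?= iff C i) -> (forall i, 0 < E2 i) ->
  \prod_i E1 i <= \prod_i E2 i ?= iff [forall i, C i].
Proof.
move=> leE E2gt0; split; first by apply: leq_prod => i _; apply: leE.
apply/eqP/forallP => [eqP12 i|allC]; last first.
  by apply: eq_bigr => i _; apply/eqP; rewrite (leE i).2.
rewrite -(leE i).2; apply: contra_eqT eqP12 => neq_i.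
rewrite neq_ltn (bigD1 i) //= [X in _ < X](bigD1 i) //=.
have lt_i : E1 i < E2 i by rewrite ltn_neqAle neq_i leE.
apply/orP; left; apply: leq_ltn_trans (_ : E1 i * \prod_(j | j != i) E2 j < _).
  by rewrite leq_mul2l; apply/orP; right; apply: leq_prod => j _; apply: leE.
by rewrite ltn_pmul2r // prodn_gt0.
Qed.

(** Multiply [leqif_chord] over all [i]: the exponents [x i] add up to the prescribed sum, so the
    resulting bound depends on that sum only, and a common positive factor cancels. *)
Lemma leqif_prod_balanced (a k r : nat) (x : 'I_a -> nat) :
  0 < k -> r <= a -> \sum_i x i = a * k + r ->
  \prod_i x i <= k.+1 ^ r * k ^ (a - r)
    ?= iff [forall i, k <= x i <= k.+1].
Proof.
move=> k0 ra sum_x.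
have := leqif_prod (fun i => leqif_chord (x i) k0)
  (fun i => ltac:(by rewrite muln_gt0 !expn_gt0 k0)).
rewrite !big_split /= !prod_nat_const card_ord -!expn_sum sum_x.
set X := \prod_i x i => leX.
have eL : X * k ^ (a * k + r) * (k.+1 ^ k) ^ a =
    (k ^ r * (k ^ (a * k) * k.+1 ^ (a * k))) * X.
  by rewrite expnD -expnM [k * a]mulnC; lia.
have eR : (k ^ k.+1) ^ a * k.+1 ^ (a * k + r) =
    (k ^ r * (k ^ (a * k) * k.+1 ^ (a * k))) * (k.+1 ^ r * k ^ (a - r)).
  have ka : k ^ a = k ^ r * k ^ (a - r) by rewrite -expnD subnKC.
  rewrite -expnM mulSn [k ^ (a + _)]expnD ka [k.+1 ^ (_ + r)]expnD.
  by rewrite [k * a]mulnC; lia.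
move: leX; rewrite eL eR => -[le eq]; split.
  by move: le; rewrite leq_pmul2l // !muln_gt0 !expn_gt0 k0.
by rewrite -eq eqn_pmul2l // !muln_gt0 !expn_gt0 k0.
Qed.

(** * Stable sets inside a vertex subset *)

Section Graph.
Variable G : sgraph.
Implicit Types (A B S : {set G}) (u v x y : G).

Lemma stableP S :
  reflect {in S &, forall x y, ~~ adj x y} (stable S).
Proof.
apply: (iffP forall_inP) => [H x y xS yS | H x xS].
  exact: (forall_inP (H x xS)).
by apply/forall_inP => y; apply: H.
Qed.

Lemma sub_stable S S' : S' \subset S -> stable S -> stable S'.
Proof.
move=> /subsetP sub /stableP H; apply/stableP => x y /sub xS /sub yS.
exact: H.
Qed.

Lemma stable1 x : stable [set x].
Proof. by apply/stableP => y z /set1P-> /set1P->; rewrite adj_irr. Qed.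

Lemma stableU1 x S :
  stable S -> {in S, forall y, ~~ adj x y} -> stable (x |: S).
Proof.
move=> /stableP Sst xS; apply/stableP => y z.
move=> /setU1P[->|yS] /setU1P[->|zS]; rewrite ?adj_irr ?xS //.
  by rewrite adj_sym xS.
exact: Sst.
Qed.

(** Working with subsets of a fixed graph lets the induction delete vertices without forming induced
    subgraphs. *)
Definition stable_subsets A := [set S : {set G} | stable S & S \subset A].

Definition closed_nbhd v := [set u | (u == v) || adj v u].

(** Deleting [u] is injective on the sets that contain [u]. *)
Lemma leq_card_stable_subsets_at A u (T : {set {set G}}) :
  (forall S, S \in stable_subsets A -> u \in S -> S :\ u \in T) ->
  #|[set S in stable_subsets A | u \in S]| <= #|T|.
Proof.
move=> ST; rewrite -(@card_in_imset _ _ (fun S => S :\ u)).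
  apply/subset_leq_card/subsetP => _ /imsetP[S + ->].
  by rewrite inE => /andP[]; apply: ST.
move=> S S'; rewrite !inE => /andP[_ uS] /andP[_ uS'] eqSS'.
by rewrite -(setD1K uS) eqSS' setD1K.
Qed.

(* Equality forces every stable set to meet B at most once, so that B is a
   clique, and each u in B to lie in |stable_subsets (A :\: B)| stable sets; an
   edge from u to y outside B would exclude [set u; y] from that count. *)
Lemma stable_subsets_nbhd A : A != set0 ->
  exists2 v, v \in A & let B := A :&: closed_nbhd v in
    #|stable_subsets A| <= #|stable_subsets (A :\: B)| * #|B|.+1 /\
    (#|stable_subsets A| = #|stable_subsets (A :\: B)| * #|B|.+1 ->
     {in B &, forall x y, adj x y = (x != y)} /\
     {in B & A :\: B, forall x y, ~~ adj x y}).
Proof.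
move=> /set0Pn[v0 v0A].
pose deg u := #|[set S in stable_subsets A | u \in S]|.
case: (@arg_maxnP _ v0 (fun x => x \in A) deg v0A) => v vA vmax; exists v => // B.
set A' := A :\: B; set F' := stable_subsets A'.
have vB : v \in B by rewrite !inE vA eqxx.
have deg_v : deg v <= #|F'|.
  apply: leq_card_stable_subsets_at => S; rewrite !inE => /andP[Sst SA] vS.
  rewrite (sub_stable (subsetDl _ _) Sst) /=.
  apply/subsetP => y /setD1P[yv yS]; rewrite !inE (subsetP SA) // andbT /=.
  by rewrite negb_or yv (stableP _ Sst).
have deg_le u : u \in B -> deg u <= #|F'|.
  by move=> /setIP[uA _]; apply: leq_trans deg_v; apply: vmax.
(* Double counting of the pairs [u \in S] with [u] in [B]. *)
have sum_deg : \sum_(u in B) deg u = \sum_(S in stable_subsets A) #|S :&: B|.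
  under eq_bigr => u _ do
    rewrite /deg -sum1_card (eq_bigl _ _ (fun S => in_set _ _)) big_mkcondr.
  rewrite exchange_big /=; apply: eq_bigr => S _.
  rewrite -big_mkcondr sum1_card; apply: eq_card => u.
  by rewrite in_setI andbC.
have F'E : #|F'| = \sum_(S in stable_subsets A) (S :&: B == set0).
  rewrite -big_mkcondr sum1_card; apply: eq_card => S.
  by rewrite inE subsetD -setI_eq0 andbA [RHS]unfold_in /= [in RHS]inE.
(* Each [S] contributes 1 to the left and [(S :&: B == set0) + #|S :&: B|] to the right; these agree
   exactly when [S] meets [B] at most once. *)
have split_le : #|stable_subsets A| <= #|F'| + \sum_(u in B) deg u
    ?= iff [forall S in stable_subsets A, #|S :&: B| <= 1].
  rewrite sum_deg F'E -big_split -sum1_card /=.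
  apply: leqif_sum => S _; rewrite -cards_eq0.
  by case: #|_| => [|[|m]].
have sum_le : \sum_(u in B) deg u <= \sum_(u in B) #|F'|
    ?= iff [forall u in B, deg u == #|F'|].
  apply: leqif_sum => u uB; split=> //; exact: deg_le.
have -> : #|F'| * #|B|.+1 = #|F'| + \sum_(u in B) #|F'|.
  by rewrite sum_nat_const mulnS mulnC.
have le2 : #|F'| + \sum_(u in B) deg u <= #|F'| + \sum_(u in B) #|F'|.
  by rewrite leq_add2l sum_le.
split=> [|eqF]; first by apply: leq_trans le2; apply: split_le.
have /forall_inP meet1 : [forall S in stable_subsets A, #|S :&: B| <= 1].
  by rewrite -split_le.2 eqn_leq split_le.1 eqF.
have /forall_inP degE : [forall u in B, deg u == #|F'|].
  by rewrite -sum_le.2 eqn_leq sum_le.1 -(leq_add2l #|F'|) -eqF split_le.1.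
split=> x y xB yB.
  have [->|xy] := eqVneq x y; first by rewrite adj_irr.
  apply: contraT => nxy.
  have /meet1 : [set x; y] \in stable_subsets A.
    rewrite inE stableU1 ?stable1 //; last by move=> z /set1P->.
    rewrite subUset !sub1set.
    by move: xB yB => /setIP[-> _] /setIP[-> _].
  have /setIidPl-> : [set x; y] \subset B by rewrite subUset !sub1set xB.
  by rewrite cards2 xy.
apply/negP => xy.
(* By [meet1], a stable set containing [x] has no other vertex in [B], so deleting [x] lands in
   [F']; it never yields [[set y]], because [x] and [y] are adjacent. *)
have : deg x <= #|F' :\ [set y]|.
  apply: leq_card_stable_subsets_at => S SA xS.
  have := SA; rewrite !inE => /andP[Sst /subsetP subSA].
  rewrite (sub_stable (subsetDl _ _) Sst) /=; apply/andP; split.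
    apply/eqP => Sy; have : y \in S :\ x by rewrite Sy set11.
    by move=> /setD1P[_ yS]; move/stableP/(_ x y xS yS): Sst; rewrite xy.
  apply/subsetP => z /setD1P[zx zS]; rewrite inE subSA // andbT.
  apply/negP => zB; have := meet1 S SA; rewrite leqNgt => /negP; apply.
  have <- : #|[set x; z]| = 2 by rewrite cards2 eq_sym zx.
  apply/subset_leq_card; rewrite subsetI !subUset !sub1set.
  by rewrite xS zS xB zB.
have yF' : [set y] \in F' by rewrite inE stable1 sub1set.
by rewrite (eqP (degE x xB)) (cardsD1 [set y] F') yF' ltnn.
Qed.

Lemma card_stable_subsets0 : #|stable_subsets set0| = 1.
Proof.
rewrite -(cards1 (set0 : {set G})); apply: eq_card => S.
rewrite !inE subset0 andbC; case: eqP => // ->.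
by apply/stableP => x y; rewrite inE.
Qed.

(** Induction on [a]: the set [B] of [stable_subsets_nbhd] receives the new colour and the rest is
    coloured recursively. Colours are plain naturals so that the bound can grow, and classes may be
    empty, each then giving a factor 1. *)
Lemma stable_colouring a A :
  (forall S, S \in stable_subsets A -> #|S| <= a) ->
  exists c : G -> nat, [/\ {in A, forall x, c x < a},
    #|stable_subsets A| <= \prod_(i < a) #|[set x in A | c x == i]|.+1
  & #|stable_subsets A| = \prod_(i < a) #|[set x in A | c x == i]|.+1 ->
    {in A &, forall x y, adj x y = (x != y) && (c x == c y)}].
Proof.
elim: a A => [|a IH] A Aa.
  exists (fun=> 0); suff -> : A = set0.
    rewrite big_ord0 card_stable_subsets0.
    by split=> // [x|_ x]; rewrite inE.
  apply/setP => x; rewrite in_set0; apply/negP => xA.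
  by have := Aa [set x]; rewrite inE stable1 sub1set xA cards1 => /(_ isT).
have [->|A0] := eqVneq A set0.
  exists (fun=> 0); rewrite card_stable_subsets0.
  by split=> [x||_ x]; rewrite ?inE // prodn_gt0.
have [v vA /=] := stable_subsets_nbhd A0.
set B := A :&: _; set A' := A :\: B => -[leF eqF].
(* No vertex of [A'] is adjacent to [v], so adding [v] enlarges any stable subset of [A']; this
   lowers the bound from [a + 1] to [a]. *)
have [S|c [cA' lec eqc]] := IH A'.
  rewrite !inE => /andP[Sst SA'].
  have vS : v \notin S.
    by apply/negP => /(subsetP SA'); rewrite !inE vA eqxx.
  have := Aa (v |: S); rewrite cardsU1 vS; apply; rewrite inE stableU1 //=.
    by rewrite subUset sub1set vA (subset_trans SA' (subsetDl _ _)).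
  move=> y /(subsetP SA'); rewrite !inE => /andP[+ yA].
  by rewrite yA negb_or => /andP[].
pose c' x := if x \in B then a else c x.
have subBA : B \subset A by apply: subsetIl.
have AE x : x \in A -> (x \in B) || (x \in A').
  by move=> xA; rewrite [x \in A']inE xA andbT orbN.
have c'B x : x \in B -> c' x = a by rewrite /c' => ->.
have c'A' x : x \in A' -> c' x = c x by rewrite /c' inE => /andP[/negbTE->].
have prodE : \prod_(i < a.+1) #|[set x in A | c' x == i]|.+1 =
    \prod_(i < a) #|[set x in A' | c x == i]|.+1 * #|B|.+1.
  rewrite big_ord_recr /=; congr (_ * _.+1).
    apply: eq_bigr => i _; congr _.+1; apply: eq_card => x.
    rewrite [LHS]inE [RHS]inE /c' [x \in A']inE.
    by case: ifP; rewrite ?andbT //= (gtn_eqF (ltn_ord i)) andbF.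
  apply: eq_card => x; rewrite inE; apply/andP/idP => [[xA]|xB]; last first.
    by rewrite c'B // (subsetP subBA).
  case/orP: (AE x xA) => // xA'.
  by rewrite c'A' // (ltn_eqF (cA' x xA')).
exists c'; rewrite prodE; split.
- move=> x /AE/orP[/c'B->//|xA']; rewrite c'A' // ltnS.
  exact/ltnW/cA'.
- by apply: leq_trans leF _; rewrite leq_mul2r lec orbT.
(* Overall equality leaves no slack in either step: first in the bound for [B], then, after
   cancelling [#|B|.+1], in the recursive bound. *)
move=> eqA; have lec' : #|stable_subsets A'| * #|B|.+1 <=
    \prod_(i < a) #|[set x in A' | c x == i]|.+1 * #|B|.+1.
  by rewrite leq_mul2r lec orbT.
have [] := eqF; first by apply/eqP; rewrite eqn_leq leF eqA.
move=> adjB adjBA'.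
have {eqc}adjA' := eqc _.
have {}/adjA' adjA' : #|stable_subsets A'| = \prod_(i < a) #|[set x in A' | c x == i]|.+1.
  by apply/eqP; rewrite eqn_leq lec -(leq_pmul2r (ltn0Sn #|B|)) -eqA.
move=> x y /AE/orP[xB|xA'] /AE/orP[yB|yA'].
- by rewrite adjB // !c'B // eqxx andbT.
- rewrite (negbTE (adjBA' _ _ xB yA')) (c'B _ xB) (c'A' _ yA').
  by rewrite (gtn_eqF (cA' _ yA')) andbF.
- rewrite adj_sym (negbTE (adjBA' _ _ yB xA')) (c'B _ yB) (c'A' _ xA').
  by rewrite (ltn_eqF (cA' _ xA')) andbF.
- by rewrite !c'A' // adjA'.
Qed.

(** * Stable sets of disjoint unions of cliques *)

(** A stable set chooses at most one vertex from each clique, so stable sets correspond to functions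
    sending each class to [None] or to one of its vertices. *)
Lemma fibonacci_index_clusters a (c : G -> 'I_a) :
  (forall x y, adj x y = (x != y) && (c x == c y)) ->
  fibonacci_index G = \prod_i #|[set x | c x == i]|.+1.
Proof.
move=> adjE.
pose D i : pred (option G) := fun o => if o is Some x then c x == i else true.
pose T (f : {ffun 'I_a -> option G}) := [set x | f (c x) == Some x].
have injT : {in family D &, injective T}.
  suff H f g : f \in family D -> T f = T g -> forall i x, f i = Some x -> g i = Some x.
    move=> f g fD gD eqT; apply/ffunP => i.
    case fi: (f i) => [x|]; first by rewrite (H f g _ _ i x fi).
    by case gi: (g i) => [x|] //; rewrite -fi (H g f _ _ i x gi).
  move=> /familyP fD eqT i x fi.
  have := fD i; rewrite fi unfold_in /= => /eqP cx.
  by move/setP/(_ x): eqT; rewrite !inE cx fi eqxx => /esym/eqP.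
transitivity #|family D|.
  rewrite -(card_in_imset injT); apply: eq_card => S; rewrite inE.
  apply/idP/imsetP => [/stableP Sst|[f _ ->]]; last first.
    apply/stableP => x y; rewrite !inE adjE => /eqP fx /eqP fy.
    apply/negP => /andP[xy /eqP cxy]; move: fx; rewrite cxy fy => -[yx].
    by rewrite yx eqxx in xy.
  exists [ffun i => [pick x in S | c x == i]].
    apply/familyP => i; rewrite ffunE unfold_in /=.
    by case: pickP => //= x /andP[].
  apply/setP => x; rewrite inE ffunE; case: pickP => [y /andP[yS cyx]|none].
    apply/idP/eqP => [xS|[<-]//]; congr Some; apply/eqP.
    by have := Sst y x yS xS; rewrite adjE cyx andbT negbK.
  by have := none x; rewrite eqxx andbT => ->.
rewrite card_family foldrE big_map big_enum /=; apply: eq_bigr => i _.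
(* The choice [None] accounts for the [+ 1] in each factor. *)
rewrite (cardD1 None) unfold_in /= add1n; congr _.+1.
rewrite -(card_imset _ Some_inj); apply: eq_card => o.
rewrite !inE; apply/andP/imsetP => [[oN]|[x + ->]].
  by case: o oN => // x _ xi; exists x; rewrite ?inE.
by rewrite inE.
Qed.

End Graph.

Lemma isomorphic_fibonacci_index (G H : sgraph) :
  isomorphic G H -> fibonacci_index G = fibonacci_index H.
Proof.
move=> [f [[g fK gK] f_mono]]; rewrite /fibonacci_index.
rewrite -(card_imset _ (imset_inj (can_inj fK))); apply: eq_card => S.
rewrite inE; apply/imsetP/stableP => [[S0 + ->]|Sst].
  rewrite inE => /stableP S0st _ _ /imsetP[x xS ->] /imsetP[y yS ->].
  by rewrite f_mono S0st.
exists (f @^-1: S).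
  rewrite inE; apply/stableP => x y; rewrite !inE => xS yS.
  by rewrite -f_mono Sst.
apply/setP => y; apply/idP/imsetP => [yS|[x + ->]]; last by rewrite inE.
by exists (g y); rewrite ?inE gK.
Qed.

Lemma card_clique (a : nat) (q : 'I_a -> nat) (i : 'I_a) :
  #|[set u : disjoint_cliques q | tag u == i]| = q i.
Proof.
pose f (x : 'I_(q i)) : disjoint_cliques q := Tagged (fun i => 'I_(q i)) x.
have f_inj : injective f by move=> x y; apply: eq_from_Tagged.
rewrite -[RHS]card_ord -(card_imset _ f_inj); apply: eq_card => u.
rewrite inE; apply/eqP/imsetP => [|[x _ ->] //].
by case: u => j x /= ji; subst j; exists x.
Qed.

Lemma f_turanE (n a : nat) :
  f_turan n a = \prod_(i < a) (turan_order n i).+1.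
Proof.
rewrite /f_turan (@fibonacci_index_clusters _ _ (fun u : turan n a => tag u)).
  by apply: eq_bigr => i _; rewrite card_clique.
by move=> u v; rewrite andbC.
Qed.

(** This is the equality case of [leqif_prod_balanced] for the factors [(turan_order n i).+1];
    taking [k = n %/ a + 1] keeps [k] positive even if [n < a]. *)
Lemma prod_turan_order (n a : nat) : 0 < a ->
  \prod_(i < a) (turan_order n i).+1 =
    (n %/ a).+2 ^ (n %% a) * (n %/ a).+1 ^ (a - n %% a).
Proof.
move=> a0; apply/eqP.
rewrite (leqif_prod_balanced (k := (n %/ a).+1)) ?(ltnW (ltn_pmod n a0)) //.
  by apply/forallP => i; rewrite turan_orderE; case: (i < _); lia.
rewrite -(eq_bigr _ (fun i _ => addn1 _)) big_split /= sum_turan_order //.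
by rewrite sum_nat_const card_ord {1}(divn_eq n a); lia.
Qed.

(** * Isomorphism with a balanced union of cliques *)

(** Only the values [k] and [k + 1] occur, so equal sums mean that [k + 1] occurs equally often on
    both sides. *)
Lemma balanced_perm (a k : nat) (x y : 'I_a -> nat) :
  (forall i, k <= x i <= k.+1) -> (forall i, k <= y i <= k.+1) ->
  \sum_i x i = \sum_i y i -> exists s : 'S_a, forall i, x i = y (s i).
Proof.
pose b (z : 'I_a -> nat) i := z i == k.+1.
have zE (z : 'I_a -> nat) : (forall i, k <= z i <= k.+1) ->
    forall i, z i = k + b z i.
  by move=> zk i; have := zk i; rewrite /b; case: eqP => /=; lia.
move=> /zE xE /zE yE.
rewrite (eq_bigr _ (fun i _ => xE i)) [RHS](eq_bigr _ (fun i _ => yE i)).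
rewrite !big_split /= => /addnI sum_b.
have countT z : count_mem true (mktuple (b z)) = \sum_i b z i.
  rewrite count_map -sum1_count big_mkcond big_enum /=.
  by apply: eq_bigr => i _; rewrite /= eqb_id.
have countF z : count_mem false (mktuple (b z)) = a - \sum_i b z i.
  have := count_predC (pred1 true) (mktuple (b z)).
  rewrite size_tuple countT => sizeE; rewrite -[X in X - _]sizeE addKn.
  by apply: eq_count => -[].
have /tuple_permP[s xs] : perm_eq (mktuple (b x)) (mktuple (b y)).
  by apply/allP => -[] _ /=; rewrite ?countT ?countF sum_b.
exists s => i; rewrite xE yE; congr (k + nat_of_bool _).
have /(congr1 (fun t => tnth t i)) := val_inj xs.
by rewrite !tnth_mktuple.
Qed.

(** A vertex [x] goes to its rank within its class, placed in the clique [s (c x)]; this map is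
    injective and the two orders agree. *)
Lemma clusters_isomorphic (G : sgraph) (a : nat) (c : G -> 'I_a)
    (q : 'I_a -> nat) (s : 'S_a) :
  (forall x y, adj x y = (x != y) && (c x == c y)) ->
  (forall i, #|[set x | c x == i]| = q (s i)) ->
  isomorphic G (disjoint_cliques q).
Proof.
move=> adjE cq; pose cl x := enum [set y | c y == c x].
have cl_mem x : x \in cl x by rewrite mem_enum inE.
have lt_rank x : index x (cl x) < q (s (c x)).
  by rewrite -cq cardE index_mem.
pose f x : disjoint_cliques q :=
  Tagged (fun i => 'I_(q i)) (Ordinal (lt_rank x)).
have f_inj : injective f.
  (* Passing to the underlying number avoids comparing ordinals of different types. *)
  move=> x y /(congr1 (fun u : {i & 'I_(q i)} =>
    (tag u, nat_of_ord (tagged u)))) /= [].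
  move=> /perm_inj cxy; have clxy : cl x = cl y by rewrite /cl cxy.
  by rewrite clxy => /index_inj; apply; rewrite ?cl_mem // -clxy.
exists f; split; last first.
  move=> x y; rewrite /= /cliques_adj /= (inj_eq perm_inj).
  by rewrite (inj_eq f_inj) adjE andbC.
apply: inj_card_bij f_inj _.
rewrite card_tagged sumnE big_map big_enum /=.
rewrite (eq_bigr _ (fun i _ => card_ord _)) (reindex_inj (@perm_inj _ s)) /=.
rewrite -(eq_bigr _ (fun i _ => cq i)) -sum1_card (partition_big c xpredT) //=.
by apply: leq_sum => i _; rewrite sum1_card cardsE.
Qed.

(** * The Turán bound and its equality case *)

Theorem theorem2 (G : sgraph) (n a : nat) (n_gt0 : 0 < n)
    (order_G : #|vertex G| = n) (stability_G : stability_number G = a) :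
  [/\ fibonacci_index G <= f_turan n a,
      f_turan n a =
        (ceil_divn n a + 1) ^ (n %% a) * (n %/ a + 1) ^ (a - n %% a)
    & fibonacci_index G = f_turan n a <-> isomorphic G (turan n a)].
Proof.
have a0 : 0 < a.
  have := @stability_number_bounds G; rewrite order_G stability_G.
  by case/(_ n_gt0)/andP.
have fibG : fibonacci_index G = #|stable_subsets [set: G]|.
  by apply: eq_card => S; rewrite !inE subsetT andbT.
have [S|c0 []] := @stable_colouring G a [set: G].
  by rewrite inE subsetT andbT -stability_G => Sst; apply: bigmax_sup Sst _.
move=> c0_lt.
pose c x : 'I_a := Ordinal (c0_lt x (in_setT x)).
have -> : \prod_(i < a) #|[set x in [set: G] | c0 x == i]|.+1 =
    \prod_(i < a) #|[set x | c x == i]|.+1.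
  by apply: eq_bigr => i _; congr _.+1; apply: eq_card => x; rewrite !inE.
rewrite -fibG => le_fib eq_fib.
have sum_c : \sum_(i < a) #|[set x | c x == i]| = n.
  rewrite -order_G -sum1_card (partition_big c xpredT) //=.
  by apply: eq_bigr => i _; rewrite sum1_card cardsE.
(* The class sizes plus one sum to [n + a = a * (n %/ a + 1) + n %% a], which fixes [k] and [r]. *)
have [le_prod eq_prod] : \prod_(i < a) #|[set x | c x == i]|.+1
    <= f_turan n a ?= iff
      [forall i, (n %/ a).+1 <= #|[set x | c x == i]|.+1 <= (n %/ a).+2].
  rewrite f_turanE prod_turan_order //.
  apply: leqif_prod_balanced => //; first exact/ltnW/ltn_pmod.
  rewrite -(eq_bigr _ (fun i _ => addn1 _)) big_split /= sum_c.
  by rewrite sum_nat_const card_ord {1}(divn_eq n a); lia.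
split; first exact: leq_trans le_fib le_prod.
  (* When [a] divides [n] the ceiling is only [n %/ a], but its factor then has exponent 0. *)
  rewrite f_turanE prod_turan_order // ceil_divnE // !addn1.
  by case: posnP => [->|]; rewrite // addn1.
split=> [eqF|/isomorphic_fibonacci_index//].
(* The product over the classes is squeezed between two equal numbers, so both equality cases apply:
   the classes are disjoint cliques and their sizes are balanced. *)
have eqP1 : fibonacci_index G = \prod_(i < a) #|[set x | c x == i]|.+1.
  by apply/eqP; rewrite eqn_leq le_fib eqF le_prod.
have balanced : [forall i, (n %/ a).+1 <= #|[set x | c x == i]|.+1 <= (n %/ a).+2].
  by rewrite -eq_prod -eqF eqP1.
have [//|||s cs] := @balanced_perm a (n %/ a)
  (fun i => #|[set x | c x == i]|) (@turan_order n a).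
- by move=> i; move/forallP: balanced => /(_ i).
- by move=> i; rewrite turan_orderE; case: (i < _); lia.
- by rewrite sum_c sum_turan_order.
apply: clusters_isomorphic cs => x y.
by rewrite (eq_fib eqP1).
Qed.
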